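(* Let $X$ be a nonempty set. An $\varepsilon$-standard operation $F\colon X^*\to X\cup\{\varepsilon\}$ is associative if and only if it is preassociative and unarily range-idempotent (i.e., $F_1\circ F^{\flat}=F^{\flat}$).
   Context: $X^*=\bigcup_{n\geqslant 0}X^n$ is the set of all finite strings over $X$ (vectors in $X^n$ are regarded as strings of length $n$), with $X^0=\{\varepsilon\}$, where $\varepsilon$ is the empty string ($\varepsilon\notin X$). Concatenation is denoted by juxtaposition, and $\varepsilon$ is neutral for it. For a function $F$ on $X^*$, $F_n=F|_{X^n}$ and $F^{\flat}=F|_{X^*\setminus\{\varepsilon\}}$. An operation $F\colon X^*\to X\cup\{\varepsilon\}$ is $\varepsilon$-standard if $F(\varepsilon)=\varepsilon$ and $F(\mathbf{x})=\varepsilon$ only if $\mathbf{x}=\varepsilon$ (so $F^\flat$ takes values in $X$). It is associative if $F(\mathbf{x}\mathbf{y}\mathbf{z})=F(\mathbf{x}\,F(\mathbf{y})\,\mathbf{z})$ for all $\mathbf{x},\mathbf{y},\mathbf{z}\in X^*$, where $F(\mathbf{y})\in X\cup\{\varepsilon\}$ is regarded as a string of length at most one. A function $F$ on $X^*$ is preassociative if for all $\mathbf{x},\mathbf{y},\mathbf{y}',\mathbf{z}\in X^*$, $F(\mathbf{y})=F(\mathbf{y}')$ implies $F(\mathbf{x}\mathbf{y}\mathbf{z})=F(\mathbf{x}\mathbf{y}'\mathbf{z})$. *)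

(* Defs.v *)
From mathcomp Require Import all_boot.
Set Implicit Arguments.
Unset Strict Implicit.
Unset Printing Implicit Defensive.

(* Strings over X are [seq X], and the codomain X ∪ {ε} of an operation is
   [option X], with [None] standing for ε. *)

Definition string_of (X : Type) (o : option X) : seq X :=
  if o is Some a then [:: a] else [::].

Definition restr_len (X Y : Type) (n : nat) (F : seq X -> Y) : n.-tuple X -> Y :=
  fun t => F t.

Definition restr_nonempty (X Y : Type) (F : seq X -> Y) :
    {s : seq X | ~~ nilp s} -> Y :=
  fun s => F (val s).

Definition eps_standard (X : Type) (F : seq X -> option X) : Prop :=
  F [::] = None /\ forall x : seq X, F x = None -> x = [::].

Definition associative_op (X : Type) (F : seq X -> option X) : Prop :=
  forall x y z : seq X, F (x ++ y ++ z) = F (x ++ string_of (F y) ++ z).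

Definition preassociative (X Y : Type) (F : seq X -> Y) : Prop :=
  forall x y y' z : seq X, F y = F y' -> F (x ++ y ++ z) = F (x ++ y' ++ z).

(* F_1 ∘ F^♭ = F^♭.  The composite is formed with [obind] because F^♭ has
   codomain [option X]; when F is ε-standard F^♭ never takes the value [None],
   so this is the ordinary composite. *)
Definition unarily_range_idempotent (X : Type) (F : seq X -> option X) : Prop :=
  obind (fun a : X => restr_len F [tuple a]) \o restr_nonempty F
    =1 restr_nonempty F.

(* Main.v *)
Require Import Defs.
From mathcomp Require Import all_boot.

(* Both directions pass through the identity F (string_of (F y)) = F y: it is
   associativity with empty context, and preassociativity propagates it to
   every context. *)

Lemma unarily_range_idempotentE (X : Type) (F : seq X -> option X) :
  F [::] = None ->
  unarily_range_idempotent F <-> forall y, F (string_of (F y)) = F y.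
Proof.
move=> F0; split=> [idF [|a s] | idF [y y_neq0]].
(* The empty string lies outside the domain of F^♭; there the identity reduces to F(ε) = ε. *)
- by rewrite F0.
- have := idF (exist _ (a :: s) isT); rewrite /= /restr_nonempty /restr_len /=.
  (* On a letter both sides evaluate F at that one-letter string; on [None], [obind] returns [None],
     which is also [F [::]]. *)
  by case: (F (a :: s)).
- rewrite /= /restr_nonempty /restr_len /=.
  by have := idF y; case: (F y).
Qed.

Theorem proposition4p3 (X : Type) (X_nonempty : inhabited X)
    (F : seq X -> option X) (F_std : eps_standard F) :
  associative_op F <-> preassociative F /\ unarily_range_idempotent F.
Proof.
have [idFE Eid] := unarily_range_idempotentE _ _ F_std.1.
split=> [assocF | [preF /idFE idF] x y z]; last exact/preF/esym/idF.
(* By associativity, F(xyz) depends on y only through F(y). *)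
split=> [x y y' z eqF | ]; first by rewrite assocF eqF -assocF.
by apply: Eid => y; have := assocF [::] y [::]; rewrite /= !cats0.
Qed.
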